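(* For every graph $G$ we have $w_T(G) \le \frac12$.
   Context: For a graph $G$ and an edge $e \in E(G)$, let $r(e)$ be the order of a largest clique of $G$ containing $e$. The Turán weights are $w_T(r) := \frac{r}{2(r-1)}$ for integers $r \ge 2$, and each edge $e$ is given weight $w_T(e) := w_T(r(e))$. For an $n$-vertex graph $G$, define $w_T(G) := \frac{2}{n^2}\sum_{e \in E(G)} w_T(e)$. *)

(* Defs.v *)
From mathcomp Require Import all_boot all_order all_algebra.
Set Implicit Arguments.
Unset Strict Implicit.
Unset Printing Implicit Defensive.
Import Order.TTheory GRing.Theory Num.Theory.
Local Open Scope ring_scope.

Record sgraph (T : finType) := SGraph {
  adj :> rel T;
  adj_sym : symmetric adj;
  adj_irr : irreflexive adj
}.

Section Turan.
Variables (T : finType) (G : sgraph T).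

(* Unordered pairs, so each edge is counted once. *)
Definition edges : {set {set T}} :=
  [set [set p.1; p.2] | p : T * T & adj G p.1 p.2].

Definition is_clique (K : {set T}) : bool :=
  [forall x in K, forall y in K, (x != y) ==> adj G x y].

Definition clique_order (e : {set T}) : nat :=
  \max_(K : {set T} | is_clique K && (e \subset K)) #|K|.

End Turan.

Definition turan_weight (r : nat) : rat := r%:R / (2 * (r%:R - 1)).

(* For the graph with no vertices the prefactor is 2 / 0 = 0. *)
Definition turan_density (T : finType) (G : sgraph T) : rat :=
  2 / #|T|%:R ^+ 2 * \sum_(e in edges G) turan_weight (clique_order G e).

(* Main.v *)
Require Import Defs.
From mathcomp Require Import all_boot all_order all_algebra.
From mathcomp Require Import ring lra.
Set Implicit Arguments.
Unset Strict Implicit.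
Unset Printing Implicit Defensive.
Import Order.TTheory GRing.Theory Num.Theory.
Local Open Scope ring_scope.

(** Symmetrization in the style of Motzkin and Straus. For fixed edge weights,
    the quadratic form [x |-> \sum_(u, v) w(uv) x_u x_v] is affine along
    [delta_u - delta_v] when [u] and [v] are not adjacent, so all the mass of
    one of them can be moved to the other without decreasing the form. Hence a
    bound by the squared total mass needs proof only when the support of [x] is
    a clique [K]. There every edge has [r(e) >= #|K|], the weights decrease in
    [r], and Cauchy-Schwarz concludes. Take [x] constant equal to [1]. *)

Section QuadraticForm.
Variables (T : finType) (R : comNzRingType).
Implicit Types (a : T -> T -> R) (x : T -> R).

Definition qform a x : R := \sum_u \sum_v a u v * x u * x v.

Definition move_mass x (u v : T) (t : R) (w : T) : R :=
  x w + t * ((w == u)%:R - (w == v)%:R).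

Lemma sum_mul_delta (f : T -> R) (u : T) : \sum_w f w * (w == u)%:R = f u.
Proof.
rewrite (bigD1 u) //= eqxx mulr1 big1 ?addr0 // => w /negPf ->.
by rewrite mulr0.
Qed.

Lemma sum_mul_move_mass (f x : T -> R) (u v : T) (t : R) :
  \sum_w f w * move_mass x u v t w = \sum_w f w * x w + t * (f u - f v).
Proof.
rewrite -(sum_mul_delta f u) -(sum_mul_delta f v) -sumrB mulr_sumr -big_split.
by apply: eq_bigr => w _; rewrite /move_mass /=; ring.
Qed.

Lemma qformE a x : qform a x = \sum_u (\sum_v a u v * x v) * x u.
Proof.
apply: eq_bigr => u _; rewrite mulr_suml; apply: eq_bigr => v _.
by rewrite mulrAC.
Qed.

(** The coefficient of [t ^+ 2] is [a u u - 2 * a u v + a v v], which vanishes; symmetry of [a]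
    merges the two linear terms into one. *)
Lemma qform_move_mass a x (u v : T) (t : R) :
    (forall p q, a p q = a q p) -> a u u = 0 -> a v v = 0 -> a u v = 0 ->
  qform a (move_mass x u v t) =
    qform a x + 2 * t * (\sum_w a u w * x w - \sum_w a v w * x w).
Proof.
move=> a_sym auu avv auv.
have avu : a v u = 0 by rewrite a_sym.
rewrite !qformE sum_mul_move_mass !sum_mul_move_mass auu avv auv avu.
have -> : \sum_w (\sum_z a w z * move_mass x u v t z) * x w =
    \sum_w (\sum_z a w z * x z) * x w +
    t * (\sum_w a u w * x w - \sum_w a v w * x w).
  rewrite -sumrB mulr_sumr -big_split; apply: eq_bigr => w _ /=.
  by rewrite sum_mul_move_mass (a_sym w u) (a_sym w v); ring.
ring.
Qed.

End QuadraticForm.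

Section Symmetrization.
Variables (T : finType) (R : realFieldType).
Implicit Types (a : T -> T -> R) (x : T -> R).

Definition supp x : {set T} := [set u | x u != 0].

Lemma sqr_sum_le (K : {set T}) x :
    (forall u, u \notin K -> x u = 0) ->
  (\sum_u x u) ^+ 2 <= #|K|%:R * \sum_u x u ^+ 2.
Proof.
move=> xK.
have sumK (f : T -> R) : (forall u, u \notin K -> f u = 0) ->
    \sum_u f u = \sum_(u in K) f u.
  move=> fK; rewrite [RHS]big_mkcond; apply: eq_bigr => u _.
  by case: ifPn => // /fK.
rewrite !sumK //; last by move=> u /xK ->; rewrite expr0n.
have [->|[u0 u0K]] := set_0Vmem K; first by rewrite !big_set0 expr0n mulr0.
have k_gt0 : 0 < #|K|%:R :> R by rewrite ltr0n; apply/card_gt0P; exists u0.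
set S := \sum_(u in K) x u; set Q := \sum_(u in K) _.
set k : R := #|K|%:R.
(* Cauchy-Schwarz as a variance: this sum of squares expands to [k * (k * Q - S ^+ 2)], and [k > 0]
   can be cancelled. *)
have : 0 <= \sum_(u in K) (k * x u - S) ^+ 2.
  by apply: sumr_ge0 => u _; apply: sqr_ge0.
have -> : \sum_(u in K) (k * x u - S) ^+ 2 = k * (k * Q - S ^+ 2).
  transitivity (\sum_(u in K) (k ^+ 2 * x u ^+ 2 - 2 * k * S * x u + S ^+ 2)).
    by apply: eq_bigr => u _; ring.
  rewrite big_split sumrB -!mulr_sumr sumr_const -mulr_natr /= -/S -/Q -/k.
  ring.
by rewrite pmulr_rge0 // subr_ge0.
Qed.

(** The right-hand side is [c] times the sum of [x u * x v] over ordered pairs with [u != v], so the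
    comparison is termwise; pairs outside the support contribute zero. *)
Lemma qform_le_off_diag a x (c : R) :
    0 <= c -> (forall u, 0 <= x u) -> (forall u, a u u = 0) ->
    (forall u v, u != v -> x u != 0 -> x v != 0 -> a u v <= c) ->
  qform a x <= c * ((\sum_u x u) ^+ 2 - \sum_u x u ^+ 2).
Proof.
move=> c0 x0 ad ac.
have -> : c * ((\sum_u x u) ^+ 2 - \sum_u x u ^+ 2) =
    \sum_u \sum_v (c * (u != v)%:R) * x u * x v.
  rewrite expr2 mulr_suml -sumrB mulr_sumr; apply: eq_bigr => u _.
  have -> : x u ^+ 2 = \sum_v x u * x v * (v == u)%:R.
    by rewrite (sum_mul_delta (fun v => x u * x v)) expr2.
  rewrite mulr_sumr -sumrB mulr_sumr; apply: eq_bigr => v _.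
  by rewrite eq_sym; case: eqP => _ /=; ring.
apply: ler_sum => u _; apply: ler_sum => v _.
have [<-|uv] := eqVneq u v; first by rewrite ad /= mulr0 !mul0r.
have [->|xu] := eqVneq (x u) 0; first by rewrite !mulr0 !mul0r.
have [->|xv] := eqVneq (x v) 0; first by rewrite !mulr0.
by rewrite mulr1; do 2![apply: ler_wpM2r => //]; apply: ac.
Qed.

Lemma qform_le_sqr_sum (G : sgraph T) a (c : R) :
    (forall u v, a u v = a v u) -> (forall u v, ~~ adj G u v -> a u v = 0) ->
    (forall x, (forall u, 0 <= x u) -> is_clique G (supp x) ->
       qform a x <= c * (\sum_u x u) ^+ 2) ->
  forall x, (forall u, 0 <= x u) -> qform a x <= c * (\sum_u x u) ^+ 2.
Proof.
move=> a_sym a_adj a_clique x.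
(* Strong induction on the size of the support. *)
have [n] := ubnP #|supp x|; elim: n x => // n IHn x /ltnSE le_xn x0.
have [/a_clique|] := boolP (is_clique G (supp x)); first exact.
rewrite negb_forall => /existsP[u]; rewrite negb_imply => /andP[ux].
rewrite negb_forall => /existsP[v]; rewrite !negb_imply => /and3P[vx uv nuv].
(* Mass will flow towards the vertex with the larger partial derivative, which makes the slope in
   [t] nonnegative. *)
wlog le_vu : u v ux vx uv nuv /
    \sum_w a v w * x w <= \sum_w a u w * x w.
  move=> H; have /orP[] := le_total (\sum_w a v w * x w) (\sum_w a u w * x w).
    exact: H.
  by apply: H => //; [rewrite eq_sym | rewrite adj_sym].
(* The choice [t = x v] empties [v] exactly: coordinates stay nonnegative and the support loses [v]
   without gaining a vertex, since [u] already lies in it. *)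
set y := move_mass x u v (x v).
have yv : y v = 0.
  by rewrite /y /move_mass eqxx eq_sym (negPf uv) /=; ring.
have y0 w : 0 <= y w.
  have [->|wv] := eqVneq w v; first by rewrite yv.
  rewrite /y /move_mass (negPf wv) subr0.
  by rewrite addr_ge0 // mulr_ge0.
have yS : \sum_w y w = \sum_w x w.
  have := sum_mul_move_mass (fun=> 1) x u v (x v).
  rewrite subrr mulr0 addr0.
  by under eq_bigr do rewrite mul1r; under [RHS]eq_bigr do rewrite mul1r.
have ltyx : (#|supp y| < #|supp x|)%N.
  apply: proper_card; apply/properP; split; last first.
    by exists v => //; rewrite inE yv eqxx.
  apply/subsetP => w; rewrite !inE; have [->|wv] := eqVneq w v.
    by rewrite yv eqxx.
  have [->|wu] := eqVneq w u; first by move: ux; rewrite inE.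
  by rewrite /y /move_mass (negPf wv) (negPf wu) subr0 mulr0 addr0.
rewrite -yS; apply: le_trans (IHn y (leq_trans ltyx le_xn) y0).
rewrite qform_move_mass // ?a_adj ?adj_irr //.
by rewrite lerDl mulr_ge0 ?subr_ge0 // mulr_ge0.
Qed.

End Symmetrization.

Lemma turan_weight_ge0 (r : nat) : (1 < r)%N -> 0 <= turan_weight r.
Proof.
move=> r1; have : 1 < r%:R :> rat by rewrite ltr1n.
by move=> ?; rewrite divr_ge0 //; lra.
Qed.

(** The weight of [r] is [1 / 2 + 1 / (2 * (r - 1))], which decreases for [r > 1]. *)
Lemma turan_weight_anti (k r : nat) :
  (1 < k)%N -> (k <= r)%N -> turan_weight r <= turan_weight k.
Proof.
move=> k1 kr.
have k1' : 1 < k%:R :> rat by rewrite ltr1n.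
have kr' : k%:R <= r%:R :> rat by rewrite ler_nat.
rewrite /turan_weight ler_pdivrMr; last by lra.
by rewrite mulrAC ler_pdivlMr; [nra | lra].
Qed.

Section Turan.
Variables (T : finType) (G : sgraph T).

Definition turan_matrix (u v : T) : rat :=
  if adj G u v then turan_weight (clique_order G [set u; v]) else 0.

Lemma clique_order_ge (K e : {set T}) :
  is_clique G K -> e \subset K -> (#|K| <= clique_order G e)%N.
Proof.
move=> cK eK; rewrite /clique_order.
by apply: (@leq_bigmax_cond _ _ (fun K : {set T} => #|K|)); rewrite cK.
Qed.

Lemma qform_turan_clique (x : T -> rat) :
    (forall u, 0 <= x u) -> is_clique G (supp x) ->
  qform turan_matrix x <= 1 / 2 * (\sum_u x u) ^+ 2.
Proof.
move=> x0 cK; set K := supp x in cK.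
have xK u : u \notin K -> x u = 0 by rewrite inE negbK => /eqP.
have ad u : turan_matrix u u = 0 by rewrite /turan_matrix adj_irr.
(* The weight formula degenerates for at most one vertex; there the support has no two distinct
   vertices and [c = 0] serves as the bound. *)
have [k1|k1] := leqP #|K| 1%N.
  have := qform_le_off_diag (lexx 0) x0 ad.
  rewrite mul0r => H; apply: le_trans (H _) _.
    move=> u v uv xu xv; case/negP: uv; move: k1 => /card_le1_eqP k1.
    by apply/eqP; apply: k1; rewrite inE.
  by rewrite mulr_ge0 // sqr_ge0.
have cw := turan_weight_ge0 k1.
apply: le_trans (qform_le_off_diag cw x0 ad _) _.
  move=> u v uv xu xv; rewrite /turan_matrix; case: ifP => // _.
  apply: turan_weight_anti => //; apply: clique_order_ge => //.
  by apply/subsetP => w; rewrite !inE => /orP[] /eqP ->.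
have := sqr_sum_le xK.
have k1' : 1 < #|K|%:R :> rat by rewrite ltr1n.
rewrite /turan_weight; set k : rat := #|K|%:R in k1' *.
(* Here [S] is the squared total mass. Clearing denominators turns the goal into
   [k * (S - Q) <= (k - 1) * S], which is [S <= k * Q], the Cauchy-Schwarz bound. *)
move: (\sum_u x u ^+ 2) ((\sum_u x u) ^+ 2) => Q S SkQ.
rewrite mulrAC ler_pdivrMr; last by lra.
by nra.
Qed.

Lemma card_ordered_edge (e : {set T}) :
    e \in edges G ->
  #|[set p : T * T | adj G p.1 p.2 & [set p.1; p.2] == e]| = 2%N.
Proof.
case/imsetP => -[a b] /=; rewrite inE /= => ab ->.
have nab : a != b by apply: contraTneq ab => ->; rewrite adj_irr.
rewrite (_ : [set _ | _ & _] = [set (a, b); (b, a)]); last first.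
  apply/setP => -[c d]; rewrite !inE /= !xpair_eqE.
  apply/andP/orP => [[cd /eqP E] | [] /andP[/eqP -> /eqP ->]]; last first.
  - by rewrite adj_sym ab setUC eqxx.
  - by rewrite ab eqxx.
  have ncd : c != d by apply: contraTneq cd => ->; rewrite adj_irr.
  have : c \in [set a; b] by rewrite -E set21.
  have : d \in [set a; b] by rewrite -E set22.
  rewrite !inE => /orP[] /eqP dE /orP[] /eqP cE; subst c d;
    rewrite ?eqxx in ncd * => //; [by right | by left].
by rewrite cards2 xpair_eqE (negPf nab).
Qed.

(** The form sums over ordered pairs, so every edge is met twice; this absorbs the factor 2 in
    [turan_density]. *)
Lemma qform_turan1 :
  qform turan_matrix (fun=> 1) =
    2 * \sum_(e in edges G) turan_weight (clique_order G e).
Proof.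
rewrite /qform pair_big /=.
under eq_bigr do rewrite !mulr1.
rewrite /turan_matrix -big_mkcond /=.
(* Grouping the ordered pairs by their edge makes the summand constant on each group. *)
rewrite (partition_big (fun p : T * T => [set p.1; p.2]) (mem (edges G))) /=;
  last by move=> p pG; apply/imsetP; exists p; rewrite ?inE.
rewrite mulr_sumr; apply: eq_bigr => e eG.
under eq_bigr => p /andP[_ /eqP ->] do [].
rewrite (eq_bigl (mem [set p : T * T | adj G p.1 p.2 & [set p.1; p.2] == e]));
  last by move=> p; rewrite !inE.
by rewrite sumr_const card_ordered_edge // mulr_natl.
Qed.

End Turan.

Theorem theorem1p6 (T : finType) (G : sgraph T) : turan_density G <= 1 / 2.
Proof.
rewrite /turan_density mulrAC -qform_turan1.
have [->|n0] := posnP #|T|.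
  by rewrite expr0n invr0 mulr0.
rewrite ler_pdivrMr; last by rewrite exprn_gt0 // ltr0n.
(* The vertex count is the total mass of the constant vector 1. *)
have -> : #|T|%:R = \sum_(u : T) (1 : rat) by rewrite sumr_const.
apply: (@qform_le_sqr_sum _ _ G) => // [u v|u v|x].
- by rewrite /turan_matrix adj_sym setUC.
- by rewrite /turan_matrix => /negPf ->.
- exact: qform_turan_clique.
Qed.
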